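(* Let $F$ be a Minkowski norm on a real vector space $V$ of dimension $n\ge 2$. Then $F$ is an $(\alpha,\beta)$-norm if and only if $F$ is $G$-invariant, where $$G=\left\{g\in GL(n,\mathbb R)\ \middle|\ g=\begin{pmatrix}A&0\\0&1\end{pmatrix},\ A\in O(n-1)\right\}.$$
   Context: A Minkowski norm on $V$ is a continuous function $F:V\to[0,\infty)$ that is $C^\infty$ and positive on $V\setminus\{0\}$, satisfies $F(\lambda y)=\lambda F(y)$ for all $\lambda>0$, and whose fundamental tensor $g_{ij}=\frac12[F^2]_{y^iy^j}$ is positive definite at every $y\neq 0$. An $(\alpha,\beta)$-norm on $V$ is a Minkowski norm expressible in the form $F=\alpha\,\phi(s)$, $s=\frac{\beta}{\alpha}$, where $\alpha=\sqrt{a_{ij}y^iy^j}$ is a Euclidean norm on $V$, $\beta=b_iy^i\in V^*$ is a linear functional, and $\phi=\phi(s)$ is a positive $C^\infty$ function on some open interval $(-b_o,b_o)$ satisfying $$\phi(s)-s\phi'(s)+(b^2-s^2)\phi''(s)>0\qquad\text{for all } |s|\le b<b_o,$$ where $b=\|\beta\|_\alpha$ is the norm of $\beta$ with respect to $\alpha$. For a subgroup $G$ of $GL(n,\mathbb R)$, a Minkowski norm $F$ on an $n$-dimensional vector space $V$ is called $G$-invariant if there is a coordinate system $(y^1,\dots,y^n)$ of $V$ (linear coordinates determined by a basis of $V$) such that $$F(y^1,y^2,\dots,y^n)=F\big((y^1,y^2,\dots,y^n)g\big)\qquad\text{for all } y\in V,\ g\in G,$$ where $(y^1,\dots,y^n)g$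 is the product of a row vector with a matrix. *)

(* Defs.v *)
From HB Require Import structures.
From mathcomp Require Import all_boot all_order all_algebra.
From mathcomp Require Import all_classical all_reals all_analysis.
Set Implicit Arguments.
Unset Strict Implicit.
Unset Printing Implicit Defensive.
Import Order.TTheory GRing.Theory Num.Theory.
Import numFieldNormedType.Exports.
Local Open Scope classical_set_scope.
Local Open Scope ring_scope.

Definition posdefmx (R : realType) (n : nat) (A : 'M[R]_n) : Prop :=
  A^T = A /\ forall u : 'rV[R]_n, u != 0 -> 0 < (u *m A *m u^T) 0 0.

Definition partial (R : realType) (n : nat) (i : 'I_n) (f : 'rV[R]_n -> R) :
    'rV[R]_n -> R :=
  fun x => 'D_(delta_mx 0 i) f x.

(* Meaningful for open [U]: the functions are total, and the values of
   [partial i f] on an open [U] depend only on [f] on [U]. *)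
Fixpoint Ck_on (R : realType) (n k : nat) (U : set 'rV[R]_n)
    (f : 'rV[R]_n -> R) : Prop :=
  match k with
  | 0%N => forall x, U x -> {for x, continuous f}
  | k'.+1 =>
      [/\ forall x, U x -> {for x, continuous f},
          forall i x, U x -> derivable f x (delta_mx 0 i)
        & forall i, Ck_on k' U (partial i f)]
  end.

Definition smooth_on (R : realType) (n : nat) (U : set 'rV[R]_n)
    (f : 'rV[R]_n -> R) : Prop :=
  forall k, Ck_on k U f.

Definition fundamental_tensor (R : realType) (n : nat) (f : 'rV[R]_n -> R)
    (x : 'rV[R]_n) : 'M[R]_n :=
  \matrix_(i, j) (2^-1 * partial j (partial i (fun z => f z ^+ 2)) x).

(* ||beta||_alpha = sqrt (a^ij b_i b_j), with (a^ij) the inverse of (a_ij) *)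
Definition dual_norm (R : realType) (n : nat) (a : 'M[R]_n) (b : 'rV[R]_n) :
    R :=
  Num.sqrt ((b *m invmx a *m b^T) 0 0).

Section Norms.
Variables (R : realType) (V : vectType R).
Local Notation n := (\dim {:V}).

(* [F] read in the linear coordinates given by the basis [e]:
   (y^1, ..., y^n) |-> F (y^1 e_1 + ... + y^n e_n). *)
Definition in_coord (e : n.-tuple V) (F : V -> R) : 'rV[R]_n -> R :=
  fun x => F (passmx.vecof e x).

(* [V] carries no topology; its canonical one, and its smooth structure, are
   those transported from R^n by any linear coordinate system.  All the
   coordinate conditions below are independent of the basis. *)
Definition minkowski_norm (F : V -> R) : Prop :=
  [/\ forall y : V, 0 <= F y,
      forall y : V, y != 0 -> 0 < F y,
      forall (l : R) (y : V), 0 < l -> F (l *: y) = l * F y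
    & forall e : n.-tuple V, basis_of {:V} e ->
      [/\ continuous (in_coord e F),
          smooth_on [set x : 'rV[R]_n | x != 0] (in_coord e F)
        & forall x : 'rV[R]_n, x != 0 -> posdefmx (fundamental_tensor (in_coord e F) x)]].

(* alpha = sqrt (a_ij y^i y^j) *)
Definition alpha_of (e : n.-tuple V) (a : 'M[R]_n) (y : V) : R :=
  let x := passmx.rVof e y in Num.sqrt ((x *m a *m x^T) 0 0).

(* beta = b_i y^i *)
Definition beta_of (e : n.-tuple V) (b : 'rV[R]_n) (y : V) : R :=
  (b *m (passmx.rVof e y)^T) 0 0.

Definition alpha_beta_norm (F : V -> R) : Prop :=
  minkowski_norm F /\
  exists (e : n.-tuple V) (a : 'M[R]_n) (b : 'rV[R]_n) (bo : R) (phi : R -> R),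
    let nb := dual_norm a b in
    [/\ basis_of {:V} e, posdefmx a & nb < bo] /\
    [/\ forall s : R, - bo < s < bo -> 0 < phi s,
        forall k (s : R), - bo < s < bo -> derivable (phi^`(k))%classic s 1,
        forall s : R, `|s| <= nb ->
          0 < phi s - s * (phi^`())%classic s
              + (nb ^+ 2 - s ^+ 2) * (phi^`(2))%classic s
      & forall y : V, y != 0 ->
          F y = alpha_of e a y * phi (beta_of e b y / alpha_of e a y)].

Definition G_invariant (G : set 'M[R]_n) (F : V -> R) : Prop :=
  exists2 e : n.-tuple V, basis_of {:V} e &
    forall (x : 'rV[R]_n) (g : 'M[R]_n), G g ->
      in_coord e F x = in_coord e F (x *m g).

End Norms.

Definition orthogonal_group (R : realType) (m : nat) : set 'M[R]_m :=
  [set A | A *m A^T = 1%:M].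
Arguments orthogonal_group : clear implicits.

(* The cast identifies sizes (n-1)+1 and n; it exists exactly when n >= 1. *)
Definition block_orthogonal_group (R : realType) (n : nat) : set 'M[R]_n :=
  [set g | g \in unitmx /\
     exists (E : (n.-1 + 1)%N = n) (A : 'M[R]_n.-1),
       orthogonal_group R n.-1 A /\ g = castmx (E, E) (block_mx A 0 0 1%:M)].
Arguments block_orthogonal_group : clear implicits.

(* Main.v *)
Require Import Defs.
From mathcomp Require Import all_boot all_order all_algebra.
From mathcomp Require Import all_classical all_reals all_analysis.
From mathcomp Require Import ring lra.
Set Implicit Arguments.
Unset Strict Implicit.
Unset Printing Implicit Defensive.
Import Order.TTheory GRing.Theory Num.Theory.
Import numFieldNormedType.Exports.
Local Open Scope classical_set_scope.
Local Open Scope ring_scope.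

(** If [F = alpha * phi (beta / alpha)], an [alpha]-orthonormal basis whose last
    vector points in the direction dual to [beta] turns [alpha] into the
    Euclidean norm and [beta] into a multiple of the last coordinate; both are
    fixed by the block group, hence so is [F] ([adapted_coordinates],
    [alpha_beta_invariant]).

    Conversely, let [f] be [F] in coordinates where it is invariant.  By
    transitivity of the orthogonal group on spheres, [f x] depends only on the
    norm of [x] and on its last coordinate, so [f] is determined by its
    restriction [q r s = f (r e_1 + s e_n)] to a plane, which is even in [r].
    One takes for [alpha] the Euclidean norm, for [beta] the last coordinate, so
    that [b = 1], and is forced to put [phi s = q (sqrt (1 - s^2)) s] on
    [-1, 1].  Three things remain, gathered in [profile_exists].

    Smoothness up to and beyond the end points.  Near [s = 1] one has
    [phi s = s * g (sqrt (s^-2 - 1))] with [g r = q r 1] smooth and even.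
    By Whitney's theorem ([even_smooth]) [g r = h (r^2)] with [h] smooth on the
    whole line, so that [s * h (s^-2 - 1)] continues [phi] smoothly past 1; the
    same works at [-1].  Whitney's theorem combines two classical facts:
    Hadamard's division lemma ([hadamard_chain]), which gives all derivatives of
    [h] on [0 <= u], and Borel's theorem ([borel]), which continues [h] to
    [u < 0] with the same Taylor coefficients at 0.

    Convexity.  With [k t = q 1 t], homogeneity turns
    [phi - s phi' + (1 - s^2) phi''] into [k'' (s / w) / w^3] where
    [w = sqrt (1 - s^2)], and at [s = 1] or [s = -1] into the second derivative
    at 0 of [q r 1] or [q r (-1)].  All of these are positive because the
    fundamental tensor is positive on the vector of the coordinate plane tangent
    to the level set of [f] ([line_convex]).

    Positivity.  [phi] is positive on [-1, 1] since [f] is, and on a slightly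
    larger interval by continuity. *)

(** * Derivatives of functions of one real variable *)

Section OneVariable.
Variable R : realType.
Implicit Types (f g : R -> R) (d : nat -> R -> R) (x y : R).

Lemma is_derive_continuous f x a : is_derive x 1 f a -> {for x, continuous f}.
Proof.
by case=> df _; apply: differentiable_continuous; apply/derivable1_diffP.
Qed.

Lemma is_derive_add f g x a b : is_derive x 1 f a -> is_derive x 1 g b ->
  is_derive x 1 (fun z => f z + g z) (a + b).
Proof. by move=> fa gb; exact: is_deriveD. Qed.

Lemma is_derive_mul f g x a b : is_derive x 1 f a -> is_derive x 1 g b ->
  is_derive x 1 (fun z => f z * g z) (a * g x + f x * b).
Proof.
move=> fa gb; apply: (@is_derive_eq R R R (fun z => f z * g z) x 1 _ _
  (is_deriveM fa gb)).
by rewrite addrC; congr (_ + _); exact: mulrC.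
Qed.

Lemma is_derive_scale c f x a : is_derive x 1 f a ->
  is_derive x 1 (fun z => c * f z) (c * a).
Proof. by move=> fa; exact: is_deriveZ. Qed.

Lemma is_derive_opp f x a : is_derive x 1 f a ->
  is_derive x 1 (fun z => - f z) (- a).
Proof. by move=> fa; exact: is_deriveN. Qed.

Lemma is_derive_const (c : R) x : is_derive x 1 (fun=> c) 0.
Proof. exact: is_derive_cst. Qed.

Lemma is_derive_var x : is_derive x 1 (fun z => z) 1.
Proof. exact: is_derive_id. Qed.

Lemma is_derive_inv f x a : is_derive x 1 f a -> f x != 0 ->
  is_derive x 1 (fun z => (f z)^-1) (- a / f x ^+ 2).
Proof.
move=> fa f0; apply: is_derive_eq (is_deriveV f0 fa) _.
by rewrite mulNr -[LHS]/(_ * _) mulNr mulrC.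
Qed.

Lemma is_derive_expn n x :
  is_derive x 1 (fun z : R => z ^+ n.+1) (n.+1%:R * x ^+ n).
Proof.
apply: DeriveDef; first exact: exprn_derivable.
by rewrite exp_derive /= [LHS]mulr1.
Qed.

Lemma is_derive_scaled f c x a :
  is_derive (c * x) 1 f a -> is_derive x 1 (fun z => f (c * z)) (a * c).
Proof.
move=> fa; have cx : is_derive x 1 (fun z => c * z) c.
  by apply: is_derive_eq (is_derive_scale c (is_derive_id x 1)) _; exact: mulr1.
exact: (@is_derive1_comp _ f (fun z => c * z)).
Qed.

(** Differentiability is asked away from [x] only, so that the lemma applies at
    points where it is still to be established. *)
Lemma mean_value f f' x y : y != x ->
    (forall z, z != x -> is_derive z 1 f (f' z)) -> continuous f ->
  exists c, [/\ c != x, `|c - x| <= `|y - x| & f y - f x = f' c * (y - x)].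
Proof.
move=> yx df cf; have [xy|xy] := ltP x y.
  have [|c|c] := @MVT R f f' x y xy.
  - by move=> z; rewrite in_itv => /andP[xz _]; apply: df; rewrite gt_eqF.
  - exact: continuous_subspaceT.
  - rewrite in_itv => /andP[xc cy] ->; exists c; split=> //.
      by rewrite gt_eqF.
    by rewrite !ger0_norm ?lerD2r ?subr_ge0 ?ltW.
have {}xy : y < x by rewrite lt_neqAle yx.
have [|c|c] := @MVT R f f' y x xy.
- by move=> z; rewrite in_itv => /andP[_ xz]; apply: df; rewrite lt_eqF.
- exact: continuous_subspaceT.
- rewrite in_itv => /andP[xc cy] e; exists c; split=> //.
  + by rewrite lt_eqF.
  + by rewrite !ler0_norm ?lerN2 ?lerD2r ?subr_le0 ?ltW.
  + by rewrite -opprB e; ring.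
Qed.

Lemma continuous_for_dist f x :
  {for x, continuous f} <->
  forall e : R, 0 < e -> exists2 r : R, 0 < r &
    forall y, `|y - x| < r -> `|f y - f x| < e.
Proof.
split.
  move=> /cvgrPdist_lt cf e /cf[r /= r0 H]; exists r => // y yx.
  by rewrite distrC; apply: H; rewrite /= distrC.
move=> H; apply/cvgrPdist_lt => e /H[r r0 {}H]; exists r => //= y.
by rewrite /= distrC => /H; rewrite distrC.
Qed.

Lemma is_derive_quad f x a C :
  (forall h, `|f (x + h) - f x - h * a| <= C * h ^+ 2) -> is_derive x 1 f a.
Proof.
move=> H; apply/is_derive1_caratheodory.
exists (fun z => if z == x then a else (f z - f x) / (z - x)); split.
- move=> z; case: eqVneq => [->|zx]; first by rewrite !subrr mulr0.
  by rewrite divfK// subr_eq0.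
- apply/continuous_for_dist => e e0; exists (e / (`|C| + 1)).
    by rewrite divr_gt0// ltr_wpDl.
  move=> y yx; rewrite eqxx; case: eqVneq => [_|neq].
    by rewrite subrr normr0.
  have d0 : 0 < `|y - x| by rewrite normr_gt0 subr_eq0.
  have -> : (f y - f x) / (y - x) - a = (f y - f x - (y - x) * a) / (y - x).
    by field; rewrite subr_eq0.
  rewrite normrM normfV ltr_pdivrMr//.
  have := H (y - x); rewrite addrCA subrr addr0 => /le_lt_trans; apply.
  rewrite -(ger0_norm (sqr_ge0 (y - x))) normrX expr2 mulrA ltr_pM2r//.
  have C1 : 0 < `|C| + 1 by rewrite ltr_wpDl.
  rewrite ltr_pdivlMr// in yx; apply: le_lt_trans yx.
  by rewrite mulrC ler_wpM2l// (le_trans (ler_norm C))// lerDl.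
- by rewrite eqxx.
Qed.

(** The difference quotient at [x0] is, by the mean value theorem, a value of
    [f'] near [x0]. *)
Lemma is_derive_removable f f' x0 :
    (forall x, x != x0 -> is_derive x 1 f (f' x)) ->
    {for x0, continuous f} -> {for x0, continuous f'} ->
  is_derive x0 1 f (f' x0).
Proof.
move=> df cf /continuous_for_dist cf'.
have {}cf : continuous f.
  move=> x; have [->//|/df] := eqVneq x x0; exact: is_derive_continuous.
apply/is_derive1_caratheodory.
exists (fun z => if z == x0 then f' x0 else (f z - f x0) / (z - x0)); split.
- move=> z; case: eqVneq => [->|zx]; first by rewrite !subrr mulr0.
  by rewrite divfK// subr_eq0.
- apply/continuous_for_dist => e /cf'[r r0 H]; exists r => // y yx.
  rewrite eqxx; case: eqVneq => [_|neq].
    by have := H x0; rewrite !subrr normr0; apply.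
  have [c [_ cx ->]] := mean_value neq df cf.
  by rewrite mulfK ?subr_eq0//; apply: H; exact: le_lt_trans yx.
- by rewrite eqxx.
Qed.

(** A smooth function on the line given with all its derivatives, so that a
    piecewise definition can prescribe them all at once. *)
Definition derivative_chain d :=
  forall j x, is_derive x 1 (d j) (d j.+1 x).

Lemma chain_continuous d j : derivative_chain d -> continuous (d j).
Proof. by move=> cd x; exact: is_derive_continuous (cd j x). Qed.

End OneVariable.

(** * Hadamard's division lemma *)

Section Hadamard.
Variable R : realType.
Implicit Types (p d : nat -> R -> R) (x r : R).

(** [r ^+ k.+1] times the [k]-th derivative of [p 0 r / r]. *)
Fixpoint hadamard_num p k : R -> R :=
  match k with
  | 0%N => p 0%N
  | k'.+1 => fun r => r ^+ k'.+1 * p k'.+1 r - k'.+1%:R * hadamard_num p k' r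
  end.

Definition hadamard_quot p k : R -> R := fun r =>
  if r == 0 then p k.+1 0 / k.+1%:R else hadamard_num p k r / r ^+ k.+1.

Lemma is_derive_hadamard_num p : derivative_chain p -> forall k r,
  is_derive r 1 (hadamard_num p k) (r ^+ k * p k.+1 r).
Proof.
move=> cp; elim=> [|k IH] r; first by rewrite expr0 mul1r; exact: cp.
apply: is_derive_eq (is_derive_add
  (is_derive_mul (is_derive_expn k r) (cp k.+1 r))
  (is_derive_opp (is_derive_scale k.+1%:R (IH r)))) _.
by ring.
Qed.

Lemma hadamard_num0 p k : p 0%N 0 = 0 -> hadamard_num p k 0 = 0.
Proof.
move=> p0; elim: k => //= k ->.
by rewrite mulr0 subr0 expr0n mul0r.
Qed.

(** Near 0 the numerator is [c * r ^+ k.+1 / k.+1] up to a function of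
    derivative [r ^+ k * (p k.+1 r - c)], where [c] is [p k.+1 0]. *)
Lemma hadamard_quot_continuous p k : derivative_chain p -> p 0%N 0 = 0 ->
  {for 0, continuous (hadamard_quot p k)}.
Proof.
move=> cp p0; apply/continuous_for_dist => e e0.
have /continuous_for_dist /(_ e e0) [d d0 H] := @chain_continuous _ _ k.+1 cp 0.
exists d => // y; rewrite subr0 => yd.
rewrite {2}/hadamard_quot eqxx /hadamard_quot; case: eqVneq => [_|y0].
  by rewrite subrr normr0.
set c := p k.+1 0.
pose v r := hadamard_num p k r + (- c / k.+1%:R) * r ^+ k.+1.
have dv (z : R) : is_derive z 1 v (z ^+ k * (p k.+1 z - c)).
  apply: is_derive_eq (is_derive_add (is_derive_hadamard_num cp k z)
    (is_derive_scale (- c / k.+1%:R) (is_derive_expn k z))) _.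
  by field; rewrite nat1r pnatr_eq0.
have cv : continuous v by move=> z; exact: is_derive_continuous (dv z).
have [z [_]] := mean_value y0 (fun z _ => dv z) cv.
rewrite !subr0 /v hadamard_num0// expr0n mulr0 addr0 subr0 => zy vy.
have yk : y ^+ k.+1 != 0 by rewrite expf_neq0.
have -> : hadamard_num p k y / y ^+ k.+1 - c / k.+1%:R =
    (z ^+ k * (p k.+1 z - c)) * y / y ^+ k.+1.
  by rewrite -vy; field; rewrite yk nat1r pnatr_eq0.
rewrite normrM normfV ltr_pdivrMr ?normr_gt0// !normrM.
rewrite exprS [_ * y ^+ k]mulrC normrM mulrA ltr_pM2r ?normr_gt0//.
have ze : `|p k.+1 z - c| < e.
  by apply: H; rewrite subr0; exact: le_lt_trans yd.
rewrite !normrX; apply: (@le_lt_trans _ _ (`|y| ^+ k * `|p k.+1 z - c|)).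
  by apply: ler_wpM2r => //; apply: lerXn2r; rewrite // nnegrE.
by rewrite mulrC ltr_pM2r// exprn_gt0// normr_gt0.
Qed.

(** Hadamard's lemma: away from 0 the derivatives of [p 0 r / r] are
    [hadamard_quot p k r], and these extend continuously through 0. *)
Lemma hadamard_chain p : derivative_chain p -> p 0%N 0 = 0 ->
  derivative_chain (hadamard_quot p).
Proof.
move=> cp p0 k.
have dne (x : R) : x != 0 ->
    is_derive x 1 (hadamard_quot p k) (hadamard_quot p k.+1 x).
  move=> x0.
  have dq : is_derive x 1 (fun r => hadamard_num p k r * (r ^+ k.+1)^-1)
      (hadamard_quot p k.+1 x).
    apply: is_derive_eq (is_derive_mul (is_derive_hadamard_num cp k x)
       (is_derive_inv (is_derive_expn k x) _)) _.
      by rewrite expf_neq0.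
    rewrite /hadamard_quot (negPf x0) /=.
    have xk : x ^+ k != 0 by rewrite expf_neq0.
    rewrite !exprS !expr0 !mulr1; move: xk; move: (x ^+ k) => t t0.
    by field; rewrite x0 t0.
  apply: near_eq_is_derive dq.
  near=> r; rewrite /hadamard_quot ifF//; apply/negbTE.
  by near: r; exact: open_neq.
move=> x; have [->|/dne//] := eqVneq x 0.
by apply: is_derive_removable => //; exact: hadamard_quot_continuous.
Unshelve. all: by end_near. Qed.

Lemma hadamard_quotE p r : p 0%N 0 = 0 -> r * hadamard_quot p 0 r = p 0%N r.
Proof.
move=> p0; rewrite /hadamard_quot; case: eqVneq => [->|r0].
  by rewrite mul0r p0.
by rewrite expr1 mulrC divfK.
Qed.

End Hadamard.

(** * Borel's theorem *)

Section Borel.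
Variable R : realType.
Implicit Types (p q : {poly R}) (d : nat -> R -> R) (c : nat -> R) (u x : R).

Definition tanh u : R := 1 - 2 / (1 + expR (2 * u)).

Lemma tanh0 : tanh 0 = 0.
Proof. by rewrite /tanh mulr0 expR0; field. Qed.

Lemma tanh_bounded u : `|tanh u| <= 1.
Proof.
have e0 := expR_gt0 (2 * u); set e := expR _ in e0 *.
have e1 : 0 < 1 + e by rewrite ltr_wpDl.
rewrite /tanh -/e ler_norml; apply/andP; split; last first.
  by rewrite gerBl divr_ge0// ltW.
rewrite lerBrDr -lerBrDl opprK ler_pdivrMr//; lra.
Qed.

(** The derivation on polynomials in [tanh u] induced by
    [tanh' = 1 - tanh ^+ 2]. *)
Definition tanh_deriv p : {poly R} := p^`() * (1 - 'X ^+ 2).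

Lemma is_derive_tanh u : is_derive u 1 tanh (1 - tanh u ^+ 2).
Proof.
have e0 := expR_gt0 (2 * u).
have e1 : 1 + expR (2 * u) != 0 by rewrite gt_eqF// ltr_wpDl.
have de : is_derive u 1 (fun z => 1 + expR (2 * z)) (expR (2 * u) * 2).
  apply: is_derive_eq (is_derive_add (is_derive_const 1 u)
    (is_derive_scaled (is_derive_expR (2 * u)))) _.
  by rewrite add0r.
apply: (is_derive_eq (f := tanh) (is_derive_add (is_derive_const 1 u)
  (is_derive_opp (is_derive_scale 2 (is_derive_inv de e1))))).
rewrite /tanh; move: e1; set e := expR _ => e1.
by field.
Qed.

Lemma is_derive_horner_tanh p u :
  is_derive u 1 (fun z => p.[tanh z]) (tanh_deriv p).[tanh u].
Proof.
have := @is_derive1_comp _ (horner p) tanh u _ _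
  (is_derive_poly p (tanh u)) (is_derive_tanh u).
by rewrite /tanh_deriv hornerM !hornerE.
Qed.

Lemma iter_tanh_deriv_Xn k j : (j <= k)%N ->
  exists2 q, iter j tanh_deriv 'X^k = 'X^(k - j) * q & q.[0] = (k ^_ j)%:R.
Proof.
elim: j => [|j IH] jk.
  by exists 1; rewrite ?subn0 ?mulr1// hornerC ffactn0.
have [q /= -> q0] := IH (ltnW jk).
have -> : (k - j = (k - j.+1).+1)%N by rewrite subnSK.
set m := (k - j.+1)%N.
exists ((m.+1%:R *: q + 'X * q^`()) * (1 - 'X ^+ 2)).
  rewrite /tanh_deriv derivM derivXn /= exprS scaler_nat.
  by rewrite mulrnAl -mulrnAr; ring.
rewrite !hornerE q0 /= expr0n/= ffactnSr -/m /=.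
have -> : m.+1 = (k - j)%N by rewrite subnSK.
by rewrite subr0 mulr1 natrM mulrC.
Qed.

Definition coef_norm p : R := \sum_(i < size p) `|p`_i|.

Lemma horner_le_coef_norm p x : `|x| <= 1 -> `|p.[x]| <= coef_norm p.
Proof.
move=> x1; rewrite horner_coef (le_trans (ler_norm_sum _ _ _))//.
apply: ler_sum => i _; rewrite normrM normrX ler_piMr// exprn_ile1//.
Qed.

(** The building block of Borel's theorem is a multiple of
    [(eps * tanh (u / eps)) ^+ k].  Each derivative of order [j < k] carries a
    factor [eps ^+ (k - j)] and is therefore uniformly small on the whole line
    when [eps] is. *)
Lemma small_jet (a : R) k : exists d, [/\ derivative_chain d,
  forall j, (j < k)%N -> d j 0 = 0, d k 0 = a &
  forall j u, (j < k)%N -> `|d j u| <= 2^-1 ^+ k].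
Proof.
pose N := \sum_(j < k) coef_norm (iter j tanh_deriv 'X^k).
have kk0 : (k ^_ k)%:R != 0 :> R by rewrite pnatr_eq0 -lt0n ffactnn fact_gt0.
have [A Aa] : exists A, A * (k ^_ k)%:R = a.
  by exists (a / (k ^_ k)%:R); rewrite divfK.
have cn0 p : 0 <= coef_norm p by apply: sumr_ge0.
have N0 : 0 <= N by apply: sumr_ge0.
have h0 : 0 < 2^-1 ^+ k :> R by rewrite exprn_gt0// invr_gt0.
have h1 : 2^-1 ^+ k <= 1 :> R.
  by rewrite exprn_ile1// ?invr_ge0// invf_le1// ler1n.
have D1 : 1 <= 1 + `|A| * N by rewrite lerDl mulr_ge0.
have D0 : 0 < 1 + `|A| * N by exact: lt_le_trans D1.
(* This [e] makes [`|A| * e * N <= 2^-1 ^+ k]; only one power of [e] is used. *)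
pose e := 2^-1 ^+ k / (1 + `|A| * N).
have e0 : 0 < e by rewrite divr_gt0.
have e1 : e <= 1 by rewrite ler_pdivrMr// mul1r (le_trans h1).
exists (fun j u =>
  A * e ^+ k * e ^- j * (iter j tanh_deriv 'X^k).[tanh (e^-1 * u)]).
have en0 : e != 0 by rewrite gt_eqF.
split.
- move=> j u.
  apply: is_derive_eq (is_derive_scale _ (is_derive_scaled (c := e^-1)
    (f := fun z => (iter j tanh_deriv 'X^k).[tanh z])
    (is_derive_horner_tanh _ _))) _.
  by rewrite /= exprS; field; rewrite en0 expf_neq0.
- move=> j jk; have [q -> _] := iter_tanh_deriv_Xn (ltnW jk).
  rewrite mulr0 tanh0 hornerM hornerXn expr0n subn_eq0 leqNgt jk /=.
  by rewrite mul0r mulr0.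
- have [q -> q0] := iter_tanh_deriv_Xn (leqnn k).
  rewrite mulr0 tanh0 subnn expr0 mul1r q0 mulfK ?expf_neq0 ?Aa//.
move=> j u jk; rewrite !normrM.
have hb := horner_le_coef_norm (iter j tanh_deriv 'X^k) (tanh_bounded (e^-1 * u)).
have cN : coef_norm (iter j tanh_deriv 'X^k) <= N.
  by rewrite /N (bigD1 (Ordinal jk))//= lerDl sumr_ge0.
rewrite !normfV !normrX (gtr0_norm e0).
have ee : e ^+ k / e ^+ j <= e.
  rewrite -expfB// -[leRHS]expr1 ler_wiXn2l// ?subn_gt0// ltW//.
rewrite -!mulrA [e ^+ k * _]mulrA.
apply: (@le_trans _ _ (`|A| * (e * N))).
  apply: ler_wpM2l => //; apply: ler_pM => //.
    by rewrite divr_ge0// exprn_ge0// ltW.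
  exact: le_trans hb cN.
rewrite mulrCA /e mulrAC ler_pdivrMr// ler_wpM2l ?(ltW h0)//.
by rewrite lerDr.
Qed.

Lemma second_order_bound (f f1 f2 : R -> R) (C : R) :
    (forall x, is_derive x 1 f (f1 x)) -> (forall x, is_derive x 1 f1 (f2 x)) ->
    (forall x, `|f2 x| <= C) ->
  forall x h, `|f (x + h) - f x - h * f1 x| <= C * h ^+ 2.
Proof.
move=> df df1 f2C x h.
have C0 : 0 <= C by apply: le_trans (f2C 0).
have cf : continuous f by move=> z; exact: is_derive_continuous (df z).
have cf1 : continuous f1 by move=> z; exact: is_derive_continuous (df1 z).
have [->|h0] := eqVneq h 0.
  by rewrite addr0 subrr mul0r subr0 normr0 mulr_ge0 ?sqr_ge0.
have xh : x + h != x by rewrite -subr_eq0 addrC addKr.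
have [y [yx yh ->]] := mean_value xh (fun z _ => df z) cf.
have [z [_ _ e1]] := mean_value yx (fun z _ => df1 z) cf1.
rewrite addrAC subrr add0r [h * _]mulrC -mulrBl e1.
rewrite -(ger0_norm (sqr_ge0 h)) normrX expr2 mulrA !normrM.
apply: ler_wpM2r => //; apply: ler_pM => //.
by rewrite addrAC subrr add0r in yh.
Qed.

Lemma norm_lim_le (v : nat -> R) (l b : R) k :
  v @ \oo --> l -> (forall n, (k <= n)%N -> `|v n| <= b) -> `|l| <= b.
Proof.
move=> vl vb; apply: (ler_cvg_to (cvg_norm vl) (cvg_cst b)).
by exists k.
Qed.

(** Borel's theorem.  The coefficient of the [k]-th summand corrects the [k]-th
    derivative at 0 left by the earlier ones, and later summands do not disturb
    it.  For fixed [j] the derivatives of order [j + 2] of the tails are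
    uniformly bounded, which allows differentiating the limit. *)
Theorem borel c : exists2 d, derivative_chain d & forall k, d k 0 = c k.
Proof.
have /choice [T HT] : forall ak : R * nat, exists d : nat -> R -> R,
    [/\ derivative_chain d, forall j, (j < ak.2)%N -> d j 0 = 0, d ak.2 0 = ak.1 &
     forall j u, (j < ak.2)%N -> `|d j u| <= 2^-1 ^+ ak.2].
  by move=> [a k]; exact: small_jet.
pose S := fix S k : nat -> R -> R := match k with
  | 0%N => fun _ _ => 0
  | k'.+1 => fun j u => S k' j u + T (c k' - S k' k' 0, k') j u end.
have cS k : derivative_chain (S k).
  elim: k => [|k IH] j x /=; first exact: is_derive_const.
  by have [cT _ _ _] := HT (c k - S k k 0, k); exact: is_derive_add.
have S0 k j : (j < k)%N -> S k j 0 = c j.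
  elim: k => // k IH; rewrite ltnS leq_eqVlt /=.
  have [_ T1 T2 _] := HT (c k - S k k 0, k).
  move=> /predU1P[->|jk]; first by rewrite T2 /= addrC subrK.
  by rewrite IH// T1// addr0.
have S_near k l j u : (j < k)%N -> (k <= l)%N ->
    `|S l j u - S k j u| <= 2 * 2^-1 ^+ k - 2 * 2^-1 ^+ l.
  move=> jk; elim: l => [|l IH]; first by rewrite leqn0 => /eqP ->;
    rewrite !subrr normr0.
  rewrite leq_eqVlt => /predU1P[->|]; first by rewrite !subrr normr0.
  rewrite ltnS => kl; have {}IH := IH kl.
  have [_ _ _ T3] := HT (c l - S l l 0, l).
  have /= tl := T3 j u (leq_trans jk kl).
  rewrite /= addrAC (le_trans (ler_normD _ _))//.
  rewrite (le_trans (lerD IH tl))// exprS mulrA divff// mul1r; lra.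
have {}S_near k l j u : (j < k)%N -> (k <= l)%N ->
    `|S l j u - S k j u| <= 2 * 2^-1 ^+ k.
  move=> jk kl; apply: le_trans (S_near _ _ _ _ jk kl) _.
  by rewrite gerBl mulr_ge0// exprn_ge0// invr_ge0.
have cvgS j u : cvg (S k j u @[k --> \oo]).
  apply/cauchy_cvgP/cauchy_exP => e e0.
  have h1 : `|2^-1 : R| < 1 by rewrite ger0_norm ?invr_ge0// invf_lt1// ltr1n.
  have /cvgrPdist_lt /(_ (e / 2)) := cvg_expr h1.
  rewrite divr_gt0// => /(_ isT) [N _ HN].
  pose k := maxn N j.+1; exists (S k j u); exists k => // l /= kl.
  rewrite /ball /= distrC; apply: le_lt_trans (S_near _ _ _ _ _ kl) _.
    by rewrite leq_maxr.
  have := HN k (leq_maxl _ _); rewrite sub0r normrN ger0_norm.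
    by rewrite ltr_pdivlMr// mulrC.
  by rewrite exprn_ge0// invr_ge0.
pose G j u := lim (S k j u @[k --> \oo]).
exists G; last first.
  move=> k; apply: cvg_lim => //; apply: cvg_near_cst.
  by exists k.+1 => // l /= kl; rewrite S0.
(* From [S k] on, the derivatives of order [j.+2] differ by a bounded amount. *)
move=> j x; pose k := j.+3.
have dD : is_derive x 1 (fun z => G j z - S k j z) (G j.+1 x - S k j.+1 x).
  apply: (@is_derive_quad _ _ _ _ (2 * 2^-1 ^+ k)) => h.
  apply: (@norm_lim_le (fun l => (S l j (x + h) - S k j (x + h)) -
     (S l j x - S k j x) - h * (S l j.+1 x - S k j.+1 x)) _ _ k).
    apply: cvgB; first apply: cvgB; try apply: cvgMr; apply: cvgB;
      first [exact: cvgS | exact: cvg_cst].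
  move=> l kl; apply: (@second_order_bound (fun z => S l j z - S k j z)
    (fun z => S l j.+1 z - S k j.+1 z) (fun z => S l j.+2 z - S k j.+2 z)).
  - move=> z; apply: is_derive_add; first exact: cS.
    by apply: is_derive_opp; exact: cS.
  - move=> z; apply: is_derive_add; first exact: cS.
    by apply: is_derive_opp; exact: cS.
  - by move=> z; exact: S_near.
have -> : G j = fun z => (G j z - S k j z) + S k j z.
  by apply/funext => z; rewrite subrK.
by apply: is_derive_eq (is_derive_add dD (cS k j x)) _; rewrite subrK.
Qed.

End Borel.

(** * Whitney's theorem on even functions *)

Section EvenFunctions.
Variable R : realType.
Implicit Types (d : nat -> R -> R) (r u x : R).

Lemma is_derive_unique (f : R -> R) x a b :
  is_derive x 1 f a -> is_derive x 1 f b -> a = b.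
Proof. by move=> [_ <-] [_ <-]. Qed.

Lemma even_chain_odd d : derivative_chain d ->
  (forall r, d 0 (- r) = d 0 r) -> forall r, d 1 (- r) = - d 1 r.
Proof.
move=> cd ed r.
have dN : is_derive r 1 (d 0) (d 1 (-1 * r) * -1).
  have -> : d 0 = fun z => d 0 (-1 * z) by apply/funext => z; rewrite mulN1r ed.
  exact: is_derive_scaled.
by rewrite (is_derive_unique (cd 0 r) dN) mulN1r mulrN1 opprK.
Qed.

(** Whitney's theorem on even functions.  On [0 <= u] the derivatives of
    [d 0 (sqrt u)] are [Q k 0 (sqrt u) / 2 ^+ k], where [Q k.+1 0] is the smooth
    even function [Q k 1 r / r]; on [u < 0] a Borel function with the same jet
    at 0 continues it. *)
Theorem even_smooth d : derivative_chain d -> (forall r, d 0 (- r) = d 0 r) ->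
  exists2 h, derivative_chain h & forall r, h 0 (r ^+ 2) = d 0 r.
Proof.
move=> cd ed.
pose Q := fix Q k : nat -> R -> R := match k with
  | 0 => d | k'.+1 => hadamard_quot (fun j => Q k' j.+1) end.
have Q10 k : derivative_chain (Q k) -> (forall r, Q k 0 (- r) = Q k 0 r) ->
    Q k 1 0 = 0.
  by move=> ck /(even_chain_odd ck)/(_ 0); rewrite oppr0; lra.
have [cQ eQ] : (forall k, derivative_chain (Q k)) /\
    (forall k r, Q k 0 (- r) = Q k 0 r).
  suff H k : derivative_chain (Q k) /\ (forall r, Q k 0 (- r) = Q k 0 r).
    by split=> k; have [] := H k.
  elim: k => [|k [cQ eQ]]; first by [].
  have Q0 := Q10 k cQ eQ.
  split=> [|r]; first by apply: hadamard_chain => // j x; exact: cQ.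
  have [->|r0] := eqVneq r 0; first by rewrite oppr0.
  have rN : - r != 0 by rewrite oppr_eq0.
  apply: (mulfI rN); rewrite [in LHS]hadamard_quotE// mulNr hadamard_quotE//.
  exact: even_chain_odd.
have QE k r : r * Q k.+1 0 r = Q k 1 r by apply: hadamard_quotE; exact: Q10.
have [B cB B0] := borel (fun k => Q k 0 0 / 2 ^+ k).
pose h k u := if u < 0 then B k u else Q k 0 (Num.sqrt u) / 2 ^+ k.
have h0 k : h k 0 = B k 0 by rewrite /h ltxx sqrtr0 B0.
have ch k : {for 0, continuous (h k)}.
  apply/continuous_for_dist => e e0.
  have /continuous_for_dist /(_ e e0) [r1 r10 H1] := @chain_continuous _ _ k cB 0.
  have cq : {for 0, continuous (fun u => Q k 0 (Num.sqrt u) / 2 ^+ k)}.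
    apply: cvgMl; apply: (@continuous_comp _ _ _ (@Num.sqrt R) (Q k 0)).
      exact: sqrt_continuous.
    exact: chain_continuous.
  have /continuous_for_dist /(_ e e0) [r2 r20 H2] := cq.
  exists (Num.min r1 r2); first by rewrite lt_min r10.
  move=> y; rewrite lt_min => /andP[y1 y2]; rewrite h0 /h; case: (ltP y 0) => _.
    exact: H1.
  by rewrite B0; have := H2 y y2; rewrite sqrtr0.
exists h; last first.
  move=> r; rewrite /h ltNge sqr_ge0 /= expr0 divr1 sqrtr_sqr.
  by case: (ger0P r) => // _; exact: eQ.
move=> k.
have dne (u : R) : u != 0 -> is_derive u 1 (h k) (h k.+1 u).
  move=> u0; rewrite {2}/h; case: (ltP u 0) => [un|up].
    apply: near_eq_is_derive (cB k u).
    near=> v; rewrite /h ifT//; near: v; exact: lt_nbhsl.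
  have {u0}up : 0 < u by rewrite lt_neqAle eq_sym u0.
  have dq := is_derive_scale (2 ^- k)
    (@is_derive1_comp _ (Q k 0) Num.sqrt u _ _ (cQ k 0 _) (is_derive1_sqrt up)).
  apply: near_eq_is_derive (is_derive_eq dq _).
    near=> v; rewrite /h ifF 1?mulrC//; apply/negbTE; rewrite -leNgt ltW//.
    by near: v; exact: lt_nbhsr.
  have s0 : Num.sqrt u != 0 by rewrite gt_eqF// sqrtr_gt0.
  by rewrite -QE exprS; field; rewrite s0 expf_neq0.
move=> u; have [->|/dne//] := eqVneq u 0.
exact: is_derive_removable.
Unshelve. all: by end_near. Qed.

End EvenFunctions.

(** * Smoothness on subsets of the line *)

Section DifferentiabilityClasses.
Variable R : realType.
Implicit Types (U V : set R) (f g : R -> R) (k : nat) (x s : R).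

(** [k]-fold differentiability, with the successive derivatives known only up
    to their values on [U]; unlike iterated [derive1] this is visibly stable
    under products and composition. *)
Fixpoint derivable_upto k U f : Prop :=
  match k with
  | 0%N => True
  | k'.+1 => exists2 f', forall x, U x -> is_derive x 1 f (f' x) &
               derivable_upto k' U f'
  end.

Definition smooth_in U f := forall k, derivable_upto k U f.

Lemma derivable_uptoS k U f : derivable_upto k.+1 U f -> derivable_upto k U f.
Proof.
by elim: k f => // k IH f [f' ff' kf']; exists f' => //; exact: IH.
Qed.

Lemma derivable_upto_const k U c : derivable_upto k U (fun=> c).
Proof.
elim: k c => // k IH c; exists (fun=> 0) => // x _; exact: is_derive_const.
Qed.

Lemma derivable_upto_id k U : derivable_upto k U id.
Proof.
case: k => // k; exists (fun=> 1) => [x _|]; first exact: is_derive_id.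
exact: derivable_upto_const.
Qed.

Lemma derivable_upto_add k U f g : derivable_upto k U f ->
  derivable_upto k U g -> derivable_upto k U (fun x => f x + g x).
Proof.
elim: k f g => // k IH f g [f' ff' kf'] [g' gg' kg'].
exists (fun x => f' x + g' x); last exact: IH.
by move=> x Ux; apply: is_derive_add; [exact: ff' | exact: gg'].
Qed.

Lemma derivable_upto_mul k U f g : derivable_upto k U f ->
  derivable_upto k U g -> derivable_upto k U (fun x => f x * g x).
Proof.
elim: k f g => // k IH f g kf kg.
have [f' ff' kf'] := kf; have [g' gg' kg'] := kg.
exists (fun x => f' x * g x + f x * g' x).
  by move=> x Ux; apply: is_derive_mul; [exact: ff' | exact: gg'].
by apply: derivable_upto_add; apply: IH => //; exact: derivable_uptoS.
Qed.

Lemma derivable_upto_comp k U V f g : derivable_upto k V f ->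
  derivable_upto k U g -> (forall x, U x -> V (g x)) ->
  derivable_upto k U (fun x => f (g x)).
Proof.
move=> + + UV; elim: k f g UV => // k IH f g UV kf kg.
have [f' ff' kf'] := kf; have [g' gg' kg'] := kg.
exists (fun x => f' (g x) * g' x).
  move=> x Ux; apply: (@is_derive1_comp _ f g); last exact: gg'.
  by apply: ff'; exact: UV.
by apply: derivable_upto_mul => //; apply: IH => //; exact: derivable_uptoS.
Qed.

Lemma derivable_upto_inv k : derivable_upto k [set x : R | x != 0] GRing.inv.
Proof.
elim: k => // k IH; exists (fun x => - 1 * (x^-1 * x^-1)).
  move=> x x0; apply: is_derive_eq (is_derive_inv (is_derive_var x) x0) _.
  by rewrite expr2 invfM.
apply: derivable_upto_mul; first exact: derivable_upto_const.
exact: derivable_upto_mul.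
Qed.

Lemma derivable_upto_sqrt k : derivable_upto k [set x : R | 0 < x] Num.sqrt.
Proof.
elim: k => // k IH; exists (fun x => 2^-1 * (Num.sqrt x)^-1).
  by move=> x x0; rewrite -invfM; exact: is_derive1_sqrt.
apply: derivable_upto_mul; first exact: derivable_upto_const.
apply: derivable_upto_comp (derivable_upto_inv k) IH _ => x /= x0.
by rewrite gt_eqF// sqrtr_gt0.
Qed.

Lemma derivable_upto_chain k U d j :
  derivative_chain d -> derivable_upto k U (d j).
Proof.
by move=> cd; elim: k j => // k IH j; exists (d j.+1).
Qed.

Lemma derivable_upto_eq k U f g : open U -> (forall x, U x -> f x = g x) ->
  derivable_upto k U f -> derivable_upto k U g.
Proof.
move=> oU fg; case: k => // k [f' ff' kf']; exists f' => // x Ux.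
apply: near_eq_is_derive (ff' x Ux).
by apply: filterS (open_nbhs_nbhs (conj oU Ux)) => y; exact: fg.
Qed.

Lemma derivable_upto_derive1 k U f : open U ->
  derivable_upto k.+1 U f -> derivable_upto k U (f^`())%classic.
Proof.
move=> oU [f' ff']; apply: derivable_upto_eq => // x Ux.
by have [_ <-] := ff' x Ux; rewrite derive1E.
Qed.

Lemma smooth_in_derivable U f : open U -> smooth_in U f ->
  forall k s, U s -> derivable (f^`(k))%classic s 1.
Proof.
move=> oU sf k s Us.
have : derivable_upto 1 U (f^`(k))%classic.
  elim: k f sf => [|k IH] f sf; first by rewrite derive1n0; exact: sf.
  by rewrite derive1Sn; apply: IH => k'; apply: derivable_upto_derive1.
by case=> f' ff' _; case: (ff' s Us).
Qed.

End DifferentiabilityClasses.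

(** * Restriction to coordinate lines and planes *)

Section CoordinateLines.
Variables (R : realType) (n : nat).
Implicit Types (F : 'rV[R]_n -> R) (p v x : 'rV[R]_n) (r t : R).

Let e (i : 'I_n) : 'rV[R]_n := delta_mx 0 i.

Lemma line_quotient F p v r :
  (fun h : R => h^-1 *: ((F \o shift (p + r *: v)) (h *: v) - F (p + r *: v))) =
  (fun h : R => h^-1 *: (((fun z => F (p + z *: v)) \o shift r) (h *: 1) -
     F (p + r *: v))).
Proof.
apply/funext => h /=; congr (_ *: (F _ - _)).
by rewrite [h *: 1]mulr1 scalerDl addrCA.
Qed.

Lemma derivable_line F p v r : derivable F (p + r *: v) v ->
  is_derive r 1 (fun z => F (p + z *: v)) ('D_v F (p + r *: v)).
Proof.
rewrite /derivable line_quotient => dF; apply: DeriveDef => //.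
by rewrite /derive line_quotient.
Qed.

Lemma derive_line F p v r a : is_derive r 1 (fun z => F (p + z *: v)) a ->
  'D_v F (p + r *: v) = a.
Proof. by case=> _ <-; rewrite /derive line_quotient. Qed.

Lemma line_chain F p (i : 'I_n) : smooth_on [set x | x != 0] F ->
  (forall r, p + r *: e i != 0) ->
  derivative_chain (fun k r => iter k (partial i) F (p + r *: e i)).
Proof.
move=> sF p0 k r /=.
have : smooth_on [set x | x != 0] (iter k (partial i) F).
  elim: k => //= k IH l; have [_ _] := IH l.+1; exact.
by move=> /(_ 1) [_ dF _]; apply: derivable_line; apply: dF; exact: p0.
Qed.

Lemma quad_form_plane (A : 'M[R]_n) (i j : 'I_n) (a b : R) : A^T = A ->
  ((a *: e i + b *: e j) *m A *m (a *: e i + b *: e j)^T) 0 0 =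
  a ^+ 2 * A i i + 2 * (a * b) * A j i + b ^+ 2 * A j j.
Proof.
move=> sA.
have E k l : (e k *m A *m (e l)^T) 0 0 = A k l.
  by rewrite -rowE trmx_delta -colE !mxE.
have Aij : A i j = A j i by rewrite -[in LHS]sA mxE.
have addE (M N : 'M[R]_1) : (M + N) 0 0 = M 0 0 + N 0 0 by rewrite mxE.
have scaleE c (M : 'M[R]_1) : (c *: M) 0 0 = c * M 0 0 by rewrite mxE.
rewrite linearD /= !linearZ /= !mulmxDl -!scalemxAl !mulmxDr -!scalemxAr.
rewrite ?mulmxDl -?scalemxAl !(addE, scaleE).
rewrite !E Aij; ring.
Qed.

(** With [d 0 t = F (sg *: e i + t *: e j)], homogeneity makes the Hessian of
    [F] on the coordinate plane at that point the rank-one form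
    [d 2 t * (b - t * a) ^+ 2] in the components [sg * a] and [b].  On a vector
    tangent to the level set of [F] the fundamental tensor is [F] times the
    Hessian, hence [d 2 t] inherits its sign. *)
Lemma line_convex F (i j : 'I_n) (sg t : R) : i != j -> sg != 0 ->
    smooth_on [set x | x != 0] F -> (forall x, x != 0 -> 0 < F x) ->
    (forall (l : R) x, 0 < l -> F (l *: x) = l * F x) ->
    (forall x, x != 0 -> posdefmx (fundamental_tensor F x)) ->
  0 < partial j (partial j F) (sg *: e i + t *: e j).
Proof.
move=> ij sg0 sF F_gt0 F_hom F_pos.
have P_neq0 (a b : R) : a != 0 -> a *: e i + b *: e j != 0.
  move=> a0; apply/negP => /eqP/rowP/(_ i); rewrite !mxE !eqxx /=.
  by rewrite (negPf ij) mulr1 mulr0 addr0 => /eqP; rewrite (negPf a0).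
pose d k r := iter k (partial j) F (sg *: e i + r *: e j).
have cd : derivative_chain d by apply: line_chain => // r; exact: P_neq0.
have d0_gt0 r : 0 < d 0 r by apply: F_gt0; exact: P_neq0.
rewrite -[_ (partial j _) _]/(d 2 t).
pose P a b := (sg * a) *: e i + b *: e j.
have FE (a b : R) : 0 < a -> F (P a b) = a * d 0 (b / a).
  move=> a0; rewrite -F_hom// scalerDr !scalerA /P mulrC.
  by rewrite [a * (b / a)]mulrCA divff ?gt_eqF// mulr1.
pose E x := F x ^+ 2.
have partial_j (G : 'rV[R]_n -> R) (g : R -> R) (a b g' : R) :
    (forall b', G (P a b') = g b') -> is_derive b 1 g g' ->
    partial j G (P a b) = g'.
  move=> Gg dg; apply: derive_line.
  by have <- : g = fun z => G (P a z) by apply/funext => z; rewrite Gg.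
have partial_i (G : 'rV[R]_n -> R) (g : R -> R) (a b g' : R) : 0 < a ->
    (forall a', 0 < a' -> G (P a' b) = g a') -> is_derive a 1 g g' ->
    partial i G (P a b) = g' / sg.
  move=> a0 Gg dg; rewrite /P addrC; apply: derive_line.
  have dg' : is_derive (sg * a) 1 (fun z => g (sg^-1 * z)) (g' * sg^-1).
    by apply: is_derive_scaled; rewrite mulKf.
  apply: near_eq_is_derive dg'; near=> z.
  rewrite -Gg; first by rewrite /P mulVKf// addrC.
  near: z.
  have cz : (fun z => sg^-1 * z) @ (sg * a) --> sg^-1 * (sg * a).
    by apply: cvgMr; exact: cvg_id.
  by apply: (cvgr_gt _ cz); rewrite mulKf.
have dj k (a b : R) :
    is_derive b 1 (fun z => d k (z / a)) (d k.+1 (b / a) / a).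
  have -> : (fun z => d k (z / a)) = (fun z => d k (a^-1 * z)).
    by apply/funext => z; rewrite mulrC.
  by rewrite [b / a]mulrC; exact: is_derive_scaled.
have di k (a b : R) : 0 < a ->
    is_derive a 1 (fun z => d k (b / z)) (d k.+1 (b / a) * (- b / a ^+ 2)).
  move=> a0; have an0 : a != 0 by rewrite gt_eqF.
  apply: is_derive_eq (@is_derive1_comp _ (d k) (fun z => b * z^-1) a _ _
    (cd k _) (is_derive_scale b (is_derive_inv (is_derive_var a) an0))) _.
  by congr (_ * _); rewrite !mulNr mulrN mul1r.
have EE (a b : R) : 0 < a ->
    E (P a b) = (a * d 0 (b / a)) * (a * d 0 (b / a)).
  by move=> a0; rewrite /E FE// expr2.
have Ej (a b : R) : 0 < a ->
    partial j E (P a b) = 2 * (a * (d 0 (b / a) * d 1 (b / a))).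
  move=> a0; apply: (partial_j _ (fun b' =>
    a * d 0 (b' / a) * (a * d 0 (b' / a)))).
    by move=> b'; exact: EE.
  have D := is_derive_scale a (dj 0 a b).
  apply: is_derive_eq (is_derive_mul D D) _.
  by field; rewrite gt_eqF.
have Ei (a b : R) : 0 < a -> partial i E (P a b) =
    2 * ((a * d 0 (b / a) - b * d 1 (b / a)) * d 0 (b / a)) / sg.
  move=> a0.
  apply: (partial_i _ (fun a' =>
    a' * d 0 (b / a') * (a' * d 0 (b / a'))) _ _ _ a0).
    by move=> a' a'0; exact: EE.
  have D := is_derive_mul (is_derive_var a) (di 0 a b a0).
  apply: is_derive_eq (is_derive_mul D D) _.
  by field; rewrite gt_eqF.
have jj : partial j (partial j E) (P 1 t) =
    2 * (d 1 t ^+ 2 + d 0 t * d 2 t).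
  apply: (partial_j _ (fun b => 2 * (1 * (d 0 (b / 1) * d 1 (b / 1))))).
    by move=> b; rewrite Ej.
  apply: is_derive_eq (is_derive_scale 2 (is_derive_scale 1
    (is_derive_mul (dj 0 1 t) (dj 1 1 t)))) _.
  by rewrite !divr1; ring.
have ji : partial i (partial j E) (P 1 t) =
    2 * (d 0 t * d 1 t - t * d 1 t ^+ 2 - t * d 0 t * d 2 t) / sg.
  apply: (partial_i _ (fun a =>
    2 * (a * (d 0 (t / a) * d 1 (t / a)))) _ _ _ ltr01).
    by move=> a; exact: Ej.
  have D := is_derive_scale 2 (is_derive_mul (is_derive_var (1 : R))
    (is_derive_mul (di 0 1 t ltr01) (di 1 1 t ltr01))).
  apply: is_derive_eq D _.
  by rewrite !divr1 expr1n; field.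
have ii : partial i (partial i E) (P 1 t) =
    2 * (d 0 t ^+ 2 - 2 * t * d 0 t * d 1 t + t ^+ 2 * d 1 t ^+ 2
         + t ^+ 2 * d 0 t * d 2 t) / sg ^+ 2.
  have -> : 2 * (d 0 t ^+ 2 - 2 * t * d 0 t * d 1 t + t ^+ 2 * d 1 t ^+ 2
         + t ^+ 2 * d 0 t * d 2 t) / sg ^+ 2 =
    (sg^-1 * (2 * (d 0 t ^+ 2 - 2 * t * d 0 t * d 1 t + t ^+ 2 * d 1 t ^+ 2
         + t ^+ 2 * d 0 t * d 2 t))) / sg by field.
  apply: (partial_i _ (fun a => sg^-1 *
      (2 * ((a * d 0 (t / a) - t * d 1 (t / a)) * d 0 (t / a)))) _ _ _ ltr01).
    by move=> a a0; rewrite (Ei _ _ a0) mulrC.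
  have D := is_derive_scale 2 (is_derive_mul
    (is_derive_add (is_derive_mul (is_derive_var (1 : R)) (di 0 1 t ltr01))
      (is_derive_opp (is_derive_scale t (di 1 1 t ltr01))))
    (di 0 1 t ltr01)).
  apply: is_derive_scale; apply: is_derive_eq D _.
  by rewrite !divr1 expr1n; field.
have x0 : P 1 t != 0 by rewrite /P mulr1; exact: P_neq0.
have [sG posG] := F_pos _ x0.
(* This vector is annihilated by the differential of [F]. *)
have u0 : (sg * d 1 t) *: e i + (t * d 1 t - d 0 t) *: e j != 0.
  have [d1|d1] := eqVneq (d 1 t) 0; last by rewrite P_neq0// mulf_neq0.
  rewrite d1 !mulr0 scale0r !add0r.
  apply/negP => /eqP/rowP/(_ j); rewrite !mxE !eqxx mulr1 => /eqP.
  by rewrite oppr_eq0 gt_eqF.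
have := posG _ u0; rewrite quad_form_plane// !mxE -/E jj ji ii.
have d00 := d0_gt0 t.
have -> : (sg * d 1 t) ^+ 2 *
   (2^-1 * (2 * (d 0 t ^+ 2 - 2 * t * d 0 t * d 1 t + t ^+ 2 * d 1 t ^+ 2 +
        t ^+ 2 * d 0 t * d 2 t) / sg ^+ 2)) +
  2 * (sg * d 1 t * (t * d 1 t - d 0 t)) *
  (2^-1 * (2 * (d 0 t * d 1 t - t * d 1 t ^+ 2 - t * d 0 t * d 2 t) / sg)) +
  (t * d 1 t - d 0 t) ^+ 2 *
  (2^-1 * (2 * (d 1 t ^+ 2 + d 0 t * d 2 t))) = d 0 t ^+ 3 * d 2 t.
  by field.
by rewrite pmulr_rgt0// exprn_gt0.
Unshelve. all: by end_near. Qed.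

End CoordinateLines.

(** * Orthogonal transformations fixing the last coordinate *)

Section OrthogonalGeometry.
Variable R : realType.

Definition sqnorm n (x : 'rV[R]_n) : R := (x *m x^T) 0 0.

Lemma sqnormE n (x : 'rV[R]_n) : sqnorm x = \sum_i x 0 i ^+ 2.
Proof. by rewrite /sqnorm mxE; apply: eq_bigr => i _; rewrite mxE expr2. Qed.

Lemma sqnorm_gt0 n (x : 'rV[R]_n) : x != 0 -> 0 < sqnorm x.
Proof.
move=> x0; rewrite lt_neqAle sqnormE sumr_ge0 ?andbT => [|i _];
  last exact: sqr_ge0.
apply: contra x0; rewrite eq_sym psumr_eq0 => [/allP x0|i _]; last exact: sqr_ge0.
apply/eqP/rowP => i; rewrite mxE; apply/eqP.
by have := x0 i (mem_index_enum i); rewrite sqrf_eq0.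
Qed.

Lemma mulmx11E n (x y : 'rV[R]_n) : x *m y^T = ((x *m y^T) 0 0)%:M.
Proof. exact: mx11_scalar. Qed.

(** The reflection in the hyperplane orthogonal to [u - v]. *)
Lemma orthogonal_transitive m (u v : 'rV[R]_m) : sqnorm u = sqnorm v ->
  exists2 A : 'M[R]_m, A *m A^T = 1%:M & u *m A = v.
Proof.
move=> uv; have [->|] := eqVneq u v.
  by exists 1%:M; rewrite ?trmx1 mulmx1.
rewrite -subr_eq0; set w := u - v => w0.
have ww := sqnorm_gt0 w0; set c := sqnorm w in ww.
have wwE : w *m w^T = c%:M by rewrite mulmx11E.
set N := w^T *m w.
have NN : N *m N = c *: N.
  by rewrite /N mulmxA -(mulmxA _ w) wwE mul_mx_scalar -scalemxAl.
have NT : N^T = N by rewrite trmx_mul trmxK.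
have AT : (1%:M - (2 / c) *: N)^T = 1%:M - (2 / c) *: N.
  by rewrite linearB linearZ /= trmx1 NT.
exists (1%:M - (2 / c) *: N).
  rewrite AT mulmxBl mul1mx mulmxBr mulmx1.
  rewrite -!scalemxAl -!scalemxAr NN !scalerA -scalerBl -addrA -opprD -scalerDl.
  have -> : 2 / c + (2 / c - 2 / c * (2 / c) * c) = 0 by field; rewrite gt_eqF.
  by rewrite scale0r subr0.
have uw : (u *m w^T) = (c / 2)%:M.
  rewrite mulmx11E; congr (_%:M).
  have vu : (v *m u^T) 0 0 = (u *m v^T) 0 0.
    by rewrite -[v *m u^T]trmxK trmx_mul trmxK [LHS]mxE.
  have subE (K L : 'M[R]_1) : (K - L) 0 0 = K 0 0 - L 0 0 by rewrite !mxE.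
  have -> : c = sqnorm u - (u *m v^T) 0 0 - ((u *m v^T) 0 0 - sqnorm v).
    by rewrite /c /sqnorm -vu /w linearB /= mulmxBl !mulmxBr !subE vu.
  by rewrite -uv /w linearB /= mulmxBr subE -/(sqnorm u); field.
rewrite mulmxBr mulmx1 -scalemxAr mulmxA uw mul_scalar_mx scalerA.
have -> : 2 / c * (c / 2) = 1 by field; rewrite gt_eqF.
by rewrite scale1r opprB addrC subrK.
Qed.

(** [x = (x', x_n)] for a size presented as [k + 1]. *)
Section LastCoordinate.
Variables (k n : nat) (E : (k + 1)%N = n).
Implicit Types (x : 'rV[R]_n) (z : 'rV[R]_(k + 1)).

Definition glue z : 'rV[R]_n := castmx (erefl, E) z.

Definition tail_coord x : 'rV[R]_1 := rsubmx (castmx (erefl, esym E) x).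

Definition head_coord x : 'rV[R]_k := lsubmx (castmx (erefl, esym E) x).

Lemma glueK x : glue (row_mx (head_coord x) (tail_coord x)) = x.
Proof.
rewrite /glue /head_coord /tail_coord hsubmxK.
by move: x; case: n / E => x; rewrite !castmx_id.
Qed.

Lemma tail_glue y t : tail_coord (glue (row_mx y t)) = t.
Proof.
by rewrite /tail_coord /glue; case: n / E; rewrite !castmx_id row_mxKr.
Qed.

Lemma sqnorm_glue y t : sqnorm (glue (row_mx y t)) = sqnorm y + t 0 0 ^+ 2.
Proof.
rewrite /glue; case: n / E; rewrite castmx_id /sqnorm tr_row_mx mul_row_col.
by rewrite mxE; congr (_ + _); rewrite -[LHS]/(sqnorm t) sqnormE big_ord1.
Qed.

Lemma glue_block y t (A : 'M[R]_k) :
  glue (row_mx y t) *m castmx (E, E) (block_mx A 0 0 1%:M) =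
  glue (row_mx (y *m A) t).
Proof.
rewrite /glue; case: n / E; rewrite !castmx_id mul_row_block.
by rewrite !mulmx0 addr0 add0r mulmx1.
Qed.

Lemma glue_col p y t (C : 'M[R]_(k, p)) (w : 'rV[R]_p) :
  glue (row_mx y t) *m castmx (E, erefl) (col_mx C w) = y *m C + t *m w.
Proof. by rewrite /glue; case: n / E; rewrite !castmx_id mul_row_col. Qed.

End LastCoordinate.

Lemma block_group_preserves n (E : (n.-1 + 1)%N = n) (x : 'rV[R]_n) g :
  block_orthogonal_group R n g ->
  sqnorm (x *m g) = sqnorm x /\ tail_coord E (x *m g) = tail_coord E x.
Proof.
move=> [_ [E' [A [OA ->]]]]; rewrite (eq_irrelevance E' E).
rewrite -(glueK E x) glue_block !sqnorm_glue !tail_glue.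
split=> //; congr (_ + _).
by rewrite /sqnorm trmx_mul mulmxA -(mulmxA _ A) OA mulmx1.
Qed.

Lemma unitmx_castmx (k n : nat) (E : k = n) (B : 'M[R]_k) :
  B \in unitmx -> castmx (E, E) B \in unitmx.
Proof. by case: n / E; rewrite castmx_id. Qed.

(** Vectors with the same norm and last coordinate have heads of the same norm,
    and a reflection exchanges the heads. *)
Lemma block_group_transitive n (E : (n.-1 + 1)%N = n) (x y : 'rV[R]_n) :
  sqnorm x = sqnorm y -> tail_coord E x = tail_coord E y ->
  exists2 g, block_orthogonal_group R n g & x *m g = y.
Proof.
rewrite -[X in sqnorm X = _](glueK E x) -[X in _ = sqnorm X -> _](glueK E y).
rewrite !sqnorm_glue => + xy; rewrite xy => /addIr.
move=> /orthogonal_transitive[A OA xA].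
exists (castmx (E, E) (block_mx A 0 0 1%:M)); last first.
  by rewrite -(glueK E x) glue_block xA xy glueK.
split; last by exists E, A.
have : block_mx A 0 0 (1%:M : 'M[R]_1) \in unitmx.
  rewrite unitmxE det_ublock det1 mulr1 -unitmxE.
  by case: (mulmx1_unit OA).
exact: unitmx_castmx.
Qed.

(** Gram-Schmidt, in the [a]-orthogonal complement of a unit vector [w]. *)
Lemma orthonormal_complement n (a : 'M[R]_n) (w : 'rV[R]_n) k : posdefmx a ->
  w *m a *m w^T = 1%:M -> (k < n)%N ->
  exists2 Q : 'M[R]_(k, n), Q *m a *m Q^T = 1%:M & Q *m a *m w^T = 0.
Proof.
move=> [sa pa] ww; elim: k => [|k IH] kn.
  by exists 0; apply/matrixP => - [].
have [Q QQ Qw] := IH (ltnW kn).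
pose M := a *m (col_mx w Q)^T.
have : kermx M != 0.
  rewrite -mxrank_eq0 mxrank_ker -lt0n subn_gt0.
  by apply: leq_ltn_trans kn; rewrite (leq_trans (rank_leq_col M)).
move=> /rowV0Pn[u /sub_kermxP uM u0].
have [uw uQ] : u *m a *m w^T = 0 /\ u *m a *m Q^T = 0.
  move: uM; rewrite /M mulmxA tr_col_mx mul_mx_row => /eqP.
  by rewrite row_mx_eq0 => /andP[/eqP-> /eqP->].
pose s := Num.sqrt ((u *m a *m u^T) 0 0).
have s0 : 0 < s by rewrite sqrtr_gt0 pa.
have s2 : s ^+ 2 = (u *m a *m u^T) 0 0 by rewrite sqr_sqrtr// ltW// pa.
pose v := s^-1 *: u.
have vQ : v *m a *m Q^T = 0 by rewrite -!scalemxAl uQ scaler0.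
have vv : v *m a *m v^T = 1%:M.
  rewrite /v linearZ /= -!scalemxAl -scalemxAr scalerA [u *m _ *m _]mx11_scalar.
  by rewrite -s2 scale_scalar_mx; congr (_%:M); field; rewrite gt_eqF.
have Qv : Q *m a *m v^T = 0.
  by apply: trmx_inj; rewrite !trmx_mul trmxK sa mulmxA vQ trmx0.
have CC : col_mx v Q *m a *m (col_mx v Q)^T = 1%:M.
  by rewrite mul_col_mx tr_col_mx mul_col_row vv vQ QQ Qv -scalar_mx_block.
have Cw : col_mx v Q *m a *m w^T = 0.
  by rewrite !mul_col_mx Qw -!scalemxAl uw scaler0 col_mx0.
by exists (col_mx v Q).
Qed.

Lemma castmx_gram k n p (E : k = n) (C : 'M[R]_(k, p)) (a : 'M[R]_p) :
  castmx (E, erefl) C *m a *m (castmx (E, erefl) C)^T =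
  castmx (E, E) (C *m a *m C^T).
Proof. by case: n / E; rewrite !castmx_id. Qed.

Lemma castmx1 k n (E : k = n) : castmx (E, E) 1%:M = 1%:M :> 'M[R]_n.
Proof. by case: n / E; rewrite castmx_id. Qed.

(** The rows of [P] are an [a]-orthonormal basis ending with the direction of
    [b *m invmx a], or with any direction when [b = 0]; the functional [b] vanishes
    on the vectors [a]-orthogonal to that direction. *)
Lemma adapted_coordinates n (E : (n.-1 + 1)%N = n) (a : 'M[R]_n) (b : 'rV[R]_n) :
  posdefmx a -> exists P : 'M[R]_n, [/\ P *m a *m P^T = 1%:M &
    exists c : R, forall x, x *m P *m b^T = c *: tail_coord E x].
Proof.
move=> pa; have [sa pa0] := pa.
have n0 : (0 < n)%N by rewrite -E addn1.
have aunit : a \in unitmx.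
  rewrite -row_free_unit -kermx_eq0; apply/rowV0P => u /sub_kermxP ua.
  apply/eqP; apply/negPn/negP => /pa0; rewrite ua mul0mx mxE ltxx.
  by [].
have [w [c [ww wb]]] : exists w : 'rV[R]_n, exists c : R,
    w *m a *m w^T = 1%:M /\ b = c *: (w *m a).
  pose v := if b == 0 then delta_mx 0 (Ordinal n0) else b *m invmx a.
  have v0 : v != 0.
    rewrite /v; have [_|b0] := eqVneq b 0; apply/negP => /eqP.
      move=> /rowP/(_ (Ordinal n0)); rewrite !mxE !eqxx => /eqP.
      by rewrite oner_eq0.
    move=> /(congr1 (mulmx^~ a)); rewrite mulmxKV// mul0mx => /eqP.
    exact/negP.
  pose s := Num.sqrt ((v *m a *m v^T) 0 0).
  have s0 : 0 < s by rewrite sqrtr_gt0 pa0.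
  have s2 : s ^+ 2 = (v *m a *m v^T) 0 0 by rewrite sqr_sqrtr// ltW// pa0.
  exists (s^-1 *: v), (if b == 0 then 0 else s); split.
    rewrite linearZ /= -!scalemxAl -scalemxAr scalerA [v *m _ *m _]mx11_scalar.
    by rewrite -s2 scale_scalar_mx; congr (_%:M); field; rewrite gt_eqF.
  rewrite /v; case: eqP => [->|_]; first by rewrite scale0r.
  by rewrite -scalemxAl scalerA divff ?gt_eqF// scale1r mulmxKV.
have kn : (n.-1 < n)%N by rewrite prednK.
have [Q QQ Qw] := orthonormal_complement pa ww kn.
exists (castmx (E, erefl) (col_mx Q w)); split.
  rewrite castmx_gram mul_col_mx tr_col_mx mul_col_row QQ ww Qw.
  have -> : w *m a *m Q^T = 0.
    by apply: trmx_inj; rewrite !trmx_mul trmxK sa trmx0 mulmxA.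
  by rewrite -scalar_mx_block castmx1.
exists c => x; rewrite -[in LHS](glueK E x) glue_col mulmxDl -!mulmxA.
have bT : b^T = c *: (a *m w^T) by rewrite wb linearZ /= trmx_mul sa.
rewrite bT -!scalemxAr [Q *m (a *m _)]mulmxA Qw [w *m (a *m _)]mulmxA ww.
by rewrite mulmx0 scaler0 add0r mulmx1.
Qed.

End OrthogonalGeometry.

(** * The profile of a plane norm *)

Section Profile.
Variable R : realType.
Variable q : R -> R -> R.
Hypothesis q_gt0 : forall r s : R, (r != 0) || (s != 0) -> 0 < q r s.
Hypothesis q_hom : forall l r s : R, 0 < l -> q (l * r) (l * s) = l * q r s.
Hypothesis q_even : forall r s, q (- r) s = q r s.
Variables k gp gm : nat -> R -> R.
Hypotheses (ck : derivative_chain k) (kE : forall t, k 0 t = q 1 t)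
  (k_convex : forall t, 0 < k 2 t).
Hypotheses (cgp : derivative_chain gp) (gpE : forall r, gp 0 r = q r 1)
  (gp_convex : 0 < gp 2 0).
Hypotheses (cgm : derivative_chain gm) (gmE : forall r, gm 0 r = q r (-1))
  (gm_convex : 0 < gm 2 0).

Let w (s : R) : R := Num.sqrt (1 - s ^+ 2).

Lemma even_second_derivative (g h : nat -> R -> R) :
  derivative_chain g -> derivative_chain h ->
  (forall r, h 0 (r ^+ 2) = g 0 r) -> g 2 0 = 2 * h 1 0.
Proof.
move=> cg ch hg.
have dh j (r : R) :
    is_derive r 1 (fun z => h j (z ^+ 2)) (h j.+1 (r ^+ 2) * (2 * r)).
  apply: is_derive_eq (@is_derive1_comp _ (h j) (fun z => z ^+ 2) r _ _
    (ch j _) (is_derive_expn 1 r)) _.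
  by rewrite expr1.
have g1 r : g 1 r = h 1 (r ^+ 2) * (2 * r).
  apply: is_derive_unique (cg 0 r) _.
  by have -> : g 0 = fun z => h 0 (z ^+ 2) by apply/funext => z; rewrite hg.
have := is_derive_mul (dh 1 0) (is_derive_scale 2 (is_derive_var 0)).
have <- : g 1 = fun z => h 1 (z ^+ 2) * (2 * z) by apply/funext => z.
move=> /(is_derive_unique (cg 1 0)) ->.
by rewrite expr0n /=; ring.
Qed.

Let wP (s : R) : `|s| < 1 -> [/\ 0 < 1 - s ^+ 2, 0 < w s & w s ^+ 2 = 1 - s ^+ 2].
Proof.
move=> s1; have w1 : 0 < 1 - s ^+ 2.
  by rewrite subr_gt0 -(ger0_norm (sqr_ge0 s)) normrX expr_lt1.
by split; rewrite ?sqrtr_gt0// sqr_sqrtr// ltW.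
Qed.

Let is_derive_w (s : R) : `|s| < 1 -> is_derive s 1 w (- s / w s).
Proof.
move=> s1; have [w1 w0 w2] := wP s1.
have d1 : is_derive s 1 (fun z => 1 - z ^+ 2) (- (2 * s)).
  apply: is_derive_eq (is_derive_add (is_derive_const 1 s)
    (is_derive_opp (is_derive_expn 1 s))) _.
  by rewrite add0r expr1.
apply: is_derive_eq (@is_derive1_comp _ Num.sqrt (fun z => 1 - z ^+ 2) s _ _
  (is_derive1_sqrt w1) d1) _.
by rewrite -/(w s); field; rewrite gt_eqF.
Qed.

(** Three expressions of the profile, valid for [0 < s], [s < 0] and [`|s| < 1],
    are used: the first two are smooth up to the end points 1 and -1 and beyond
    thanks to Whitney's theorem, the last one is smooth across 0 and makes the
    convexity inequality a multiple of [k 2]. *)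
Theorem profile_exists : exists (bo : R) (phi : R -> R), [/\ 1 < bo,
  forall s, - bo < s < bo -> 0 < phi s,
  forall j s, - bo < s < bo -> derivable (phi^`(j))%classic s 1,
  forall s, `|s| <= 1 -> 0 < phi s - s * (phi^`())%classic s
      + (1 - s ^+ 2) * (phi^`(2))%classic s &
  forall s, `|s| <= 1 -> phi s = q (Num.sqrt (1 - s ^+ 2)) s].
Proof.
have gp_even r : gp 0 (- r) = gp 0 r by rewrite !gpE.
have gm_even r : gm 0 (- r) = gm 0 r by rewrite !gmE.
have [hp chp hpE] := even_smooth cgp gp_even.
have [hm chm hmE] := even_smooth cgm gm_even.
(* [v s] is the square of [sqrt (1 - s ^+ 2) / s]. *)
pose v (s : R) := s^-1 * s^-1 - 1.
pose phip s := s * hp 0 (v s).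
pose phim s := -1 * s * hm 0 (v s).
pose phi0 s := w s * k 0 (s / w s).
pose phi s := if 0 < s then phip s else if s < 0 then phim s else k 0 0.
have phiE s : `|s| <= 1 -> phi s = q (w s) s.
  move=> s1; have w1 : 0 <= 1 - s ^+ 2.
    by rewrite subr_ge0 -(ger0_norm (sqr_ge0 s)) normrX expr_le1.
  rewrite /phi; case: ltgtP => [s0|s0|<-].
  - have sv : (w s / s) ^+ 2 = v s.
      rewrite /v expr_div_n sqr_sqrtr//; field; rewrite gt_eqF//.
    rewrite /phip -sv hpE gpE -q_hom// mulr1 mulrC divfK//.
    by rewrite gt_eqF.
  - have sv : (w s / - s) ^+ 2 = v s.
      by rewrite /v expr_div_n sqr_sqrtr//; field; rewrite lt_eqF.
    rewrite /phim mulN1r -sv hmE gmE -q_hom ?oppr_gt0//.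
    rewrite mulrN1 opprK mulrC divfK//.
    by rewrite oppr_eq0 lt_eqF.
  - by rewrite kE /w expr0n subr0 sqrtr1.
have phi0E s : `|s| < 1 -> phi s = phi0 s.
  move=> s1; have [_ w0 _] := wP s1.
  rewrite phiE ?ltW// /phi0 kE -q_hom// mulr1 mulrC divfK// gt_eqF//.
have oU0 : open [set s : R | `|s| < 1].
  have -> : [set s : R | `|s| < 1] = [set s | -1 < s] `&` [set s | s < 1].
    by apply/seteqP; split=> s /=; rewrite ltr_norml => /andP.
  by apply: openI; [exact: open_gt | exact: open_lt].
have phipE s : 0 < s -> phip s = phi s by rewrite /phi => ->.
have phimE s : s < 0 -> phim s = phi s.
  by move=> s0; rewrite /phi ifF ?s0//; apply/negbTE; rewrite -leNgt ltW.
have smooth_v (U : set R) j : (forall s, U s -> s != 0) -> derivable_upto j U v.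
  move=> U0.
  have iU : derivable_upto j U (fun s => s^-1).
    exact: derivable_upto_comp (derivable_upto_inv R j)
      (derivable_upto_id j U) U0.
  apply: derivable_upto_add; first exact: derivable_upto_mul.
  exact: derivable_upto_const.
have smooth_p : smooth_in [set s | 0 < s] phi.
  move=> j; apply: (derivable_upto_eq _ phipE); first exact: open_gt.
  apply: derivable_upto_mul; first exact: derivable_upto_id.
  apply: derivable_upto_comp (derivable_upto_chain j setT 0 chp) _ _ => //.
  by apply: smooth_v => s /= s0; rewrite gt_eqF.
have smooth_m : smooth_in [set s | s < 0] phi.
  move=> j; apply: (derivable_upto_eq _ phimE); first exact: open_lt.
  apply: derivable_upto_mul.
    apply: derivable_upto_mul; first exact: derivable_upto_const.
    exact: derivable_upto_id.
  apply: derivable_upto_comp (derivable_upto_chain j setT 0 chm) _ _ => //.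
  by apply: smooth_v => s /= s0; rewrite lt_eqF.
have smooth_0 : smooth_in [set s | `|s| < 1] phi.
  move=> j; apply: (@derivable_upto_eq _ _ _ phi0); first exact: oU0.
    by move=> s /phi0E ->.
  have wj : derivable_upto j [set s | `|s| < 1] w.
    apply: derivable_upto_comp (derivable_upto_sqrt R j) _ _; last first.
      by move=> s /wP[].
    have -> : (fun s : R => 1 - s ^+ 2) = (fun s => 1 + -1 * (s * s)).
      by apply/funext => s; rewrite mulN1r expr2.
    apply: derivable_upto_add; first exact: derivable_upto_const.
    apply: derivable_upto_mul; first exact: derivable_upto_const.
    by apply: derivable_upto_mul; exact: derivable_upto_id.
  apply: derivable_upto_mul => //.
  apply: derivable_upto_comp (derivable_upto_chain j setT 0 ck) _ _ => //.
  apply: derivable_upto_mul; first exact: derivable_upto_id.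
  apply: derivable_upto_comp (derivable_upto_inv R j) wj _ => s /wP[_ w0 _] /=.
  by rewrite gt_eqF.
have derivable_phi j s : derivable (phi^`(j))%classic s 1.
  have [s0|s0|->] := ltgtP s 0.
  - exact: smooth_in_derivable smooth_m _ _ s0.
  - exact: smooth_in_derivable smooth_p _ _ s0.
  - by apply: smooth_in_derivable smooth_0 _ _ _ => //=; rewrite normr0.
pose u s := s / w s.
have du (s : R) : `|s| < 1 -> is_derive s 1 u ((w s) ^- 3).
  move=> s1; have [_ w0 w2] := wP s1; have wn0 : w s != 0 by rewrite gt_eqF.
  apply: is_derive_eq (is_derive_mul (is_derive_var s)
    (is_derive_inv (is_derive_w s1) wn0)) _.
  have -> : w s ^- 3 = (w s ^+ 2 + s ^+ 2) / w s ^+ 3 by rewrite w2 subrK mul1r.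
  by field.
pose D1 s := -1 * (u s * k 0 (u s)) + k 1 (u s) * ((w s)^-1 * (w s)^-1).
have dku j (s : R) : `|s| < 1 ->
    is_derive s 1 (fun z => k j (u z)) (k j.+1 (u s) * (w s) ^- 3).
  by move=> s1; apply: (@is_derive1_comp _ (k j) u); [exact: ck | exact: du].
have near_lt1 (s : R) : `|s| < 1 -> \near s, `|s| < 1.
  by move=> s1; exact: open_nbhs_nbhs.
have dphi (s : R) : `|s| < 1 -> is_derive s 1 phi (D1 s).
  move=> s1; have [_ w0 w2] := wP s1; have wn0 : w s != 0 by rewrite gt_eqF.
  have D : is_derive s 1 phi0 (D1 s).
    apply: is_derive_eq (is_derive_mul (is_derive_w s1) (dku 0 s s1)) _.
    by rewrite /D1 /u; field.
  apply: near_eq_is_derive D.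
  by apply: filterS (near_lt1 s s1) => z /phi0E.
have convex_in (s : R) : `|s| < 1 -> 0 < phi s - s * (phi^`())%classic s
    + (1 - s ^+ 2) * (phi^`(2))%classic s.
  move=> s1; have [_ w0 w2] := wP s1; have wn0 : w s != 0 by rewrite gt_eqF.
  have phi1E (z : R) : `|z| < 1 -> (phi^`())%classic z = D1 z.
    by move=> /dphi[_ <-]; rewrite derive1E.
  have winv := is_derive_inv (is_derive_w s1) wn0.
  have D := is_derive_add
    (is_derive_scale (-1) (is_derive_mul (du s s1) (dku 0 s s1)))
    (is_derive_mul (dku 1 s s1) (is_derive_mul winv winv)).
  have {D} [_] := near_eq_is_derive (filterS (fun z zs => esym (phi1E z zs))
    (near_lt1 s s1)) D.
  rewrite -derive1E -[X in (X^`())%classic]derive1n1 -derive1nS => ->.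
  rewrite phi1E// phi0E// -w2 /D1 /phi0 -/(u s).
  set K0 := k 0 _; set K1 := k 1 _.
  have := k_convex (u s); set K2 := k 2 _ => K20.
  rewrite /u; set W := w s in w0 w2 wn0 *.
  (* The coefficient of [K0] vanishes since [W ^+ 2 + s ^+ 2 = 1]. *)
  rewrite [X in 0 < X](_ : _ = K2 / W ^+ 3 + K0 * (W ^+ 2 + s ^+ 2 - 1) / W).
    by rewrite w2 subrK subrr mulr0 mul0r addr0 divr_gt0// exprn_gt0.
  by field.
have dv (s : R) : s != 0 -> is_derive s 1 v (- 2 / s ^+ 3).
  move=> s0; have D := is_derive_inv (is_derive_var s) s0.
  apply: is_derive_eq (is_derive_add (is_derive_mul D D)
    (is_derive_const (-1) s)) _.
  by field.
have dhv (h : nat -> R -> R) (s : R) : derivative_chain h -> s != 0 ->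
    is_derive s 1 (fun z => h 0 (v z)) (h 1 (v s) * (- 2 / s ^+ 3)).
  by move=> ch s0; apply: (@is_derive1_comp _ (h 0) v); [exact: ch | exact: dv].
have convex_at1 : 0 < phi 1 - 1 * (phi^`())%classic 1.
  have D := is_derive_mul (is_derive_var 1) (dhv hp 1 chp (oner_neq0 R)).
  have [_] := near_eq_is_derive (filterS phipE (lt_nbhsr ltr01)) D.
  rewrite -derive1E => ->; rewrite -phipE ?ltr01// /phip.
  have -> : v 1 = 0 by rewrite /v invr1 mulr1 subrr.
  have := even_second_derivative cgp chp hpE; rewrite expr1n divr1 => g2.
  move: gp_convex; rewrite g2; lra.
have convex_atN1 : 0 < phi (-1) - (-1) * (phi^`())%classic (-1).
  have N10 : -1 < 0 :> R by rewrite ltrN10.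
  have N1n0 : -1 != 0 :> R by rewrite lt_eqF.
  have D := is_derive_mul (is_derive_scale (-1) (is_derive_var (-1)))
    (dhv hm (-1) chm N1n0).
  have [_] := near_eq_is_derive (filterS phimE (lt_nbhsl N10)) D.
  rewrite -derive1E => ->; rewrite -phimE// /phim.
  have -> : v (-1) = 0 by rewrite /v invrN1 mulrNN mulr1 subrr.
  have := even_second_derivative cgm chm hmE.
  have -> : (-1 : R) ^+ 3 = -1 by ring.
  move=> g2; rewrite invrN1; move: gm_convex; rewrite g2; lra.
have phi_gt0 s : `|s| <= 1 -> 0 < phi s.
  move=> s1; rewrite phiE//; apply: q_gt0; have [->|] := eqVneq s 0.
    by rewrite /w expr0n subr0 sqrtr1 oner_eq0.
  by rewrite orbT.
have cphi : continuous phi.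
  move=> s; apply: differentiable_continuous; apply/derivable1_diffP.
  exact: (derivable_phi 0).
have pos1 : 0 < phi 1 by rewrite phi_gt0// normr1.
have posN1 : 0 < phi (-1) by rewrite phi_gt0// normrN normr1.
have /continuous_for_dist /(_ _ pos1) [r1 r10 H1] := cphi 1.
have /continuous_for_dist /(_ _ posN1) [r2 r20 H2] := cphi (-1).
exists (1 + Num.min r1 r2), phi; split=> //.
- by rewrite ltrDl lt_min r10.
- move=> s /andP[sl sr].
  have [s1|] := leP `|s| 1; first exact: phi_gt0.
  rewrite lter_normr => /orP[s1|s1].
    have : `|s - 1| < r1.
      rewrite gtr0_norm ?subr_gt0// ltrBlDl (lt_le_trans sr)//.
      by rewrite lerD2l ge_min lexx.
    by move=> /H1; rewrite ltr_distl subrr => /andP[].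
  have : `|s - -1| < r2.
    rewrite opprK ltr0_norm; last lra.
    have : Num.min r1 r2 <= r2 by rewrite ge_min lexx orbT.
    lra.
  by move=> /H2; rewrite ltr_distl subrr => /andP[].
move=> s; rewrite le_eqVlt => /predU1P[s1|s1]; last first.
  exact: convex_in.
have s2 : s ^+ 2 = 1 by rewrite -(ger0_norm (sqr_ge0 s)) normrX s1 expr1n.
rewrite s2 subrr mul0r addr0.
move/eqP: s2; rewrite sqrf_eq1 => /predU1P[->|/eqP->].
  exact: convex_at1.
exact: convex_atN1.
Qed.

End Profile.

(** * Minkowski norms *)

Section CoordinateForm.
Variable R : realType.

Lemma tail_coordE k n (E : (k + 1)%N = n) (x : 'rV[R]_n) (j : 'I_n) :
  j = k :> nat -> tail_coord E x = (x 0 j)%:M.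
Proof.
move=> jk; rewrite [LHS]mx11_scalar; congr (_%:M).
rewrite mxE castmxE; congr (x _ _); first exact: ord1.
by apply: val_inj; rewrite /= jk addn0.
Qed.

Lemma sqnorm_plane n (i j : 'I_n) (r s : R) : i != j ->
  sqnorm (r *: delta_mx 0 i + s *: delta_mx 0 j) = r ^+ 2 + s ^+ 2.
Proof.
move=> ij; have := @quad_form_plane R n 1%:M i j r s (trmx1 _ _).
rewrite mulmx1 /sqnorm => ->.
by rewrite !mxE !eqxx [j == i]eq_sym (negPf ij) !mulr1n mulr0n; ring.
Qed.

(** The level sets of the norm and the last coordinate [j] are the orbits of the
    group, so [f] is read off from its restriction to the plane of the
    coordinates [i] and [j]. *)
Lemma coordinate_profile n (f : 'rV[R]_n -> R) : (2 <= n)%N ->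
    smooth_on [set x | x != 0] f -> (forall x, x != 0 -> 0 < f x) ->
    (forall (l : R) x, 0 < l -> f (l *: x) = l * f x) ->
    (forall x, x != 0 -> posdefmx (fundamental_tensor f x)) ->
    (forall x g, block_orthogonal_group R n g -> f x = f (x *m g)) ->
  exists (j : 'I_n) (bo : R) (phi : R -> R), [/\ 1 < bo,
    forall s, - bo < s < bo -> 0 < phi s,
    forall l s, - bo < s < bo -> derivable (phi^`(l))%classic s 1,
    forall s, `|s| <= 1 -> 0 < phi s - s * (phi^`())%classic s
        + (1 - s ^+ 2) * (phi^`(2))%classic s &
    forall x, x != 0 ->
      f x = Num.sqrt (sqnorm x) * phi (x 0 j / Num.sqrt (sqnorm x))].
Proof.
move=> n2 sf f_gt0 f_hom f_pos f_inv.
have E : (n.-1 + 1)%N = n by rewrite addn1 prednK// ltnW.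
pose i := Ordinal (ltnW n2).
have jn : (n.-1 < n)%N by rewrite prednK// ltnW.
pose j := Ordinal jn.
have ij : i != j by rewrite -val_eqE /= neq_ltn -ltnS prednK ?n2// ltnW.
have f_level x y : sqnorm x = sqnorm y -> x 0 j = y 0 j -> f x = f y.
  move=> xy xyj; have [|g Gg <-] := block_group_transitive (E := E) xy.
    by rewrite !(tail_coordE E _ (j := j))// xyj.
  exact: f_inv.
pose q r s := f (r *: delta_mx 0 i + s *: delta_mx 0 j).
have plane_neq0 (r s : R) : (r != 0) || (s != 0) ->
    r *: delta_mx 0 i + s *: delta_mx 0 j != 0 :> 'rV[R]_n.
  move=> rs; apply/negP => /eqP xy0.
  have : r ^+ 2 + s ^+ 2 == 0.
    by rewrite -(sqnorm_plane _ _ ij) xy0 /sqnorm mul0mx mxE.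
  rewrite paddr_eq0 ?sqr_ge0// !sqrf_eq0.
  by case/orP: rs => /negPf->; rewrite ?andbF.
have plane_j (r s : R) :
    (r *: delta_mx 0 i + s *: delta_mx 0 j : 'rV[R]_n) 0 j = s.
  by rewrite !mxE !eqxx [j == i]eq_sym (negPf ij) mulr0 mulr1 add0r.
have q_gt0 (r s : R) : (r != 0) || (s != 0) -> 0 < q r s.
  by move=> rs; apply: f_gt0; exact: plane_neq0.
have q_hom (l r s : R) : 0 < l -> q (l * r) (l * s) = l * q r s.
  by move=> l0; rewrite /q -f_hom// scalerDr !scalerA.
have q_even (r s : R) : q (- r) s = q r s.
  by apply: f_level; rewrite ?plane_j// !sqnorm_plane// sqrrN.
have chain_i (sg : R) : sg != 0 -> derivative_chain
    (fun l r => iter l (partial i) f (sg *: delta_mx 0 j + r *: delta_mx 0 i)).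
  move=> sg0; apply: line_chain => // r.
  by rewrite addrC plane_neq0// sg0 orbT.
have chain_j : derivative_chain
    (fun l r => iter l (partial j) f (1 *: delta_mx 0 i + r *: delta_mx 0 j)).
  by apply: line_chain => // r; rewrite plane_neq0// oner_neq0.
have N10 : -1 != 0 :> R by rewrite oppr_eq0 oner_neq0.
have ji : j != i by rewrite eq_sym.
have [||||||bo [phi [bo1 phi_gt0 phi_sm phi_cv phiE]]] :=
  profile_exists q_gt0 q_hom q_even chain_j _ _ (chain_i 1 (oner_neq0 _)) _ _
    (chain_i (-1) N10) _ _.
- by [].
- by move=> t; apply: line_convex; rewrite ?oner_neq0.
- by move=> r; rewrite /= addrC.
- by apply: line_convex; rewrite ?oner_neq0.
- by move=> r; rewrite /= addrC.
- exact: line_convex.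
exists j, bo, phi; split=> // x x0.
have xx0 := sqnorm_gt0 x0; set al := Num.sqrt _.
have al0 : 0 < al by rewrite sqrtr_gt0.
have al2 : al ^+ 2 = sqnorm x by rewrite sqr_sqrtr// ltW.
have xj : x 0 j ^+ 2 <= al ^+ 2.
  rewrite al2 sqnormE (bigD1 j)//= lerDl sumr_ge0// => l _; exact: sqr_ge0.
have s1 : (x 0 j / al) ^+ 2 <= 1.
  by rewrite expr_div_n ler_pdivrMr ?mul1r// exprn_gt0.
rewrite phiE; last first.
  by rewrite -(@expr_le1 _ 2)// -normrX ger0_norm// sqr_ge0.
rewrite -q_hom//; apply: f_level; last first.
  by rewrite plane_j mulrC divfK// gt_eqF.
rewrite sqnorm_plane// [(al * Num.sqrt _) ^+ 2]exprMn.
rewrite [Num.sqrt (1 - _) ^+ 2]sqr_sqrtr ?subr_ge0// -al2.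
by field; rewrite gt_eqF.
Qed.

End CoordinateForm.

Section Equivalence.
Import passmx.
Variables (R : realType) (V : vectType R).
Local Notation n := (\dim {:V}).

Lemma basis_change (e : n.-tuple V) (P : 'M[R]_n) : basis_of {:V} e ->
  P \in unitmx -> exists2 e' : n.-tuple V, basis_of {:V} e' &
    forall x, vecof e' x = vecof e (x *m P).
Proof.
move=> eB uP.
pose e' := [tuple vecof e (row i P) | i < n].
have e'E x : vecof e' x = vecof e (x *m P).
  rewrite mulmx_sum_row linear_sum; apply: eq_bigr => i _.
  by rewrite linearZ /= nth_mktuple.
exists e' => //; rewrite basisEdim size_tuple leqnn andbT.
apply/subvP => y _; rewrite -(rVofK eB y).
rewrite -(mulmxKV uP (rVof e y)) -e'E /vecof.
apply: memv_suml => i _; apply: memvZ; apply: memv_span.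
by rewrite mem_nth// size_tuple.
Qed.

Lemma alpha_beta_invariant (F : V -> R) : (0 < n)%N -> alpha_beta_norm F ->
  G_invariant (block_orthogonal_group R n) F.
Proof.
move=> n0 [[_ _ F_hom _] [e [a [b [bo [phi [[eB pa _] [_ _ _ FE]]]]]]]].
have E : (n.-1 + 1)%N = n by rewrite addn1 prednK.
have [P [Pa [c Pb]]] := adapted_coordinates E b pa.
have [uP _] : P \in unitmx /\ a *m P^T \in unitmx.
  by apply: mulmx1_unit; rewrite mulmxA.
have [e' e'B e'E] := basis_change eB uP.
exists e' => // x g Gg; rewrite /in_coord !e'E.
have [sg tg] := block_group_preserves E x Gg.
have alphaE z : alpha_of e a (vecof e (z *m P)) = Num.sqrt (sqnorm z).
  rewrite /alpha_of vecofK// trmx_mul mulmxA -(mulmxA z) -(mulmxA z).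
  by rewrite Pa mulmx1.
have betaE z : beta_of e b (vecof e (z *m P)) = (c *: tail_coord E z) 0 0.
  by rewrite /beta_of vecofK// -Pb -[b in LHS]trmxK -trmx_mul mxE.
have [gu _] := Gg.
have [->|x0] := eqVneq x 0; first by rewrite !mul0mx.
have xP0 z : z != 0 -> vecof e (z *m P) != 0.
  rewrite vecof_eq0//; apply: contra => /eqP zP.
  by rewrite -(mulmxK uP z) zP mul0mx.
have xg0 : x *m g != 0.
  by apply: contra x0 => /eqP xg; rewrite -(mulmxK gu x) xg mul0mx.
by rewrite !FE ?xP0// !alphaE !betaE sg tg.
Qed.

Lemma invariant_alpha_beta (F : V -> R) : (2 <= n)%N -> minkowski_norm F ->
  G_invariant (block_orthogonal_group R n) F -> alpha_beta_norm F.
Proof.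
move=> n2 mF [e eB F_inv]; split=> //.
have [F_ge0 F_gt0 F_hom /(_ e eB)[_ sF F_pos]] := mF.
have [||j [bo [phi [bo1 phi_gt0 phi_sm phi_cv phiE]]]] :=
  coordinate_profile n2 sF _ _ F_pos F_inv.
- by move=> x x0; apply: F_gt0; rewrite vecof_eq0.
- by move=> l x l0; rewrite /in_coord linearZ /= F_hom.
exists e, 1%:M, (delta_mx 0 j), bo, phi => nb.
have nb1 : nb = 1.
  rewrite /nb /dual_norm invmx1 mulmx1 trmx_delta mul_delta_mx.
  by rewrite mxE sqrtr1.
rewrite nb1; split.
  split=> //; split; first exact: trmx1.
  by move=> u u0; rewrite mulmx1; exact: sqnorm_gt0.
split=> //.
  by move=> s /phi_cv; rewrite expr1n.
move=> y y0; have x0 : rVof e y != 0 by rewrite rVof_eq0.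
have alphaE : alpha_of e 1%:M y = Num.sqrt (sqnorm (rVof e y)).
  by rewrite /alpha_of mulmx1.
have betaE : beta_of e (delta_mx 0 j) y = rVof e y 0 j.
  by rewrite /beta_of -rowE !mxE.
by rewrite alphaE betaE -phiE// /in_coord rVofK.
Qed.

End Equivalence.

Theorem theorem2p2 (R : realType) (V : vectType R) (F : V -> R)
    (hn : (2 <= \dim {:V})%N) (hF : minkowski_norm F) :
  alpha_beta_norm F <-> G_invariant (block_orthogonal_group R (\dim {:V})) F.
Proof.
split; last exact: invariant_alpha_beta.
by apply: alpha_beta_invariant; exact: ltnW.
Qed.
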